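(* Let $W$ be a cocompact discrete reflection group of a CAT(0) space $X$, let $C$ be a chamber, and let $S$ be a minimal subset of the set $R$ of reflections in $W$ such that $C=\bigcap_{s\in S}X_s^+$. Let $x_0\in C$ and $w\in W$. Then there exists a reduced representation $w=s_1\cdots s_l$ ($s_i\in S$, $l=\ell(w)$) such that $$d_H([x_0,wx_0],P_{s_1,\dots,s_l})\le\operatorname{diam}\overline{C},$$ where $d_H$ is the Hausdorff distance, $[x,y]$ denotes the geodesic segment from $x$ to $y$, and $P_{s_1,\dots,s_l}=[x_0,s_1x_0]\cup[s_1x_0,(s_1s_2)x_0]\cup\cdots\cup[(s_1\cdots s_{l-1})x_0,wx_0]$.
   Context: An isometry $r$ of a geodesic space $X$ is a reflection if $r^2=\mathrm{id}$, the fixed-point set $F_r$ (the wall of $r$) has empty interior, $X\setminus F_r$ has exactly two convex connected components, and $r$ interchanges them. A reflection group is an isometry group generated by reflections. Let $W$ be a reflection group of $X$ acting properly (i.e. $\{\gamma\in W: \gamma x\in B(x,N)\}$ is finite for all $x\in X$, $N>0$), and $R$ the set of all reflections of $X$ lying in $W$. A chamber is a connected component $C$ of $X\setminus\bigcup_{r\in R}F_r$. $W$ is a cocompact discrete reflection group if $\overline{C}$ is compact and $\{\gamma\in W: \gamma C=C\}=\{1\}$. For $r\in R$, $X_r^+$ denotes the component of $X\setminus F_r$ containing $C$. $S\subset R$ is minimal with $C=\bigcap_{s\in S}X_s^+$; then $(W,S)$ is a Coxeter system, and $\ell$ is word length with respect to $S$. In a CAT(0) space geodesic segments between two points are unique.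 *)

(* Defs.v *)
From HB Require Import structures.
From mathcomp Require Import all_boot all_order all_algebra.
From mathcomp Require Import boolp classical_sets functions cardinality reals ereal.
Set Implicit Arguments. Unset Strict Implicit. Unset Printing Implicit Defensive.
Import Order.TTheory GRing.Theory Num.Theory.
Local Open Scope classical_set_scope.
Local Open Scope ring_scope.

Section Defs.
Variables (R : realType) (T : Type) (d : T -> T -> R).

Definition is_metric : Prop :=
  [/\ forall x, d x x = 0,
      forall x y, d x y = 0 -> x = y,
      forall x y, d x y = d y x &
      forall x y z, d x z <= d x y + d y z].

Definition ball (x : T) (e : R) : set T := [set y | d x y < e].
Definition mopen (U : set T) : Prop :=
  forall x, U x -> exists2 e : R, 0 < e & ball x e `<=` U.
Definition has_empty_interior (A : set T) : Prop :=
  ~ exists x, exists2 e : R, 0 < e & ball x e `<=` A.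
Definition mclosure (A : set T) : set T :=
  [set x | forall e : R, 0 < e -> exists2 y, A y & d x y < e].
Definition mconnected (A : set T) : Prop :=
  forall U V : set T, mopen U -> mopen V -> A `<=` U `|` V ->
    A `&` U `&` V = set0 -> A `&` U !=set0 -> A `&` V !=set0 -> False.
Definition component_of (A H : set T) : Prop :=
  [/\ H `<=` A, H !=set0, mconnected H &
      forall D, mconnected D -> H `<=` D -> D `<=` A -> D = H].
Definition mcompact (K : set T) : Prop :=
  forall (I : Type) (U : I -> set T), (forall i, mopen (U i)) ->
    K `<=` \bigcup_i U i ->
    exists (n : nat) (f : nat -> I), K `<=` [set x | exists2 i, (i < n)%N & U (f i) x].
Definition diam (A : set T) : R := sup [set d x y | x in A & y in A].
Definition hausdorff_dist (A B : set T) : \bar R :=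
  ereal_inf [set e%:E | e in [set e : R | 0 <= e /\
     (forall a, A a -> exists2 b, B b & d a b <= e) /\
     (forall b, B b -> exists2 a, A a & d b a <= e)]].

Definition geodesic (x y : T) (g : R -> T) : Prop :=
  [/\ g 0 = x, g (d x y) = y &
      forall s t, 0 <= s <= d x y -> 0 <= t <= d x y -> d (g s) (g t) = `|s - t|].
(* [x,y]: the union of the images of all geodesics from x to y
   (this is the geodesic segment, unique in a CAT(0) space) *)
Definition segment (x y : T) : set T :=
  [set z | exists g, geodesic x y g /\ exists2 t, 0 <= t <= d x y & g t = z].
Definition geodesic_space : Prop := forall x y, exists g, geodesic x y g.
Definition convex (A : set T) : Prop :=
  forall x y, A x -> A y -> segment x y `<=` A.

(* CAT(0): geodesic space in which, for every geodesic triangle, the distance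
   between points on two sides issued from a common vertex x is at most the
   distance between the comparison points in the Euclidean comparison
   triangle (computed by the law of cosines). *)
Definition CAT0 : Prop :=
  geodesic_space /\
  forall x y z gy gz s t, geodesic x y gy -> geodesic x z gz ->
    0 < d x y -> 0 < d x z -> 0 <= s <= d x y -> 0 <= t <= d x z ->
    d (gy s) (gz t) ^+ 2 <=
      s ^+ 2 + t ^+ 2
      - s * t * (d x y ^+ 2 + d x z ^+ 2 - d y z ^+ 2) / (d x y * d x z).

Definition isometry (f : T -> T) : Prop :=
  (forall x y, d (f x) (f y) = d x y) /\ bijective f.
Definition Fix (f : T -> T) : set T := [set x | f x = x].
Definition reflection (r : T -> T) : Prop :=
  [/\ isometry r, r \o r = id, has_empty_interior (Fix r) &
    exists H1 H2, [/\ H1 <> H2, component_of (~` Fix r) H1,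
      component_of (~` Fix r) H2,
      (forall H, component_of (~` Fix r) H -> H = H1 \/ H = H2) &
      [/\ convex H1, convex H2, r @` H1 = H2 & r @` H2 = H1]]].

Definition wprod (s : seq (T -> T)) : T -> T := foldr (fun f g => f \o g) id s.
Definition word_in (S : set (T -> T)) (s : seq (T -> T)) : Prop :=
  forall i, (i < size s)%N -> S (nth id s i).

Definition reflection_group (W : set (T -> T)) : Prop :=
  [/\ W id, forall f g, W f -> W g -> W (f \o g),
      (forall f, W f -> exists2 g, W g & g \o f = id /\ f \o g = id),
      forall f, W f -> isometry f &
      forall f, W f -> exists2 s, word_in [set r | W r /\ reflection r] s &
                                  wprod s = f].
Definition acts_properly (W : set (T -> T)) : Prop :=
  forall x (N : R), 0 < N -> finite_set [set g | W g /\ ball x N (g x)].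

Definition refls (W : set (T -> T)) : set (T -> T) := [set r | W r /\ reflection r].
Definition walls (W : set (T -> T)) : set T := \bigcup_(r in refls W) Fix r.
Definition chamber (W : set (T -> T)) (C : set T) : Prop :=
  component_of (~` walls W) C.
Definition cocompact_discrete (W : set (T -> T)) (C : set T) : Prop :=
  mcompact (mclosure C) /\ (forall g, W g -> g @` C = C -> g = id).

Definition Xplus (s : T -> T) (C : set T) : set T :=
  [set x | exists H, [/\ component_of (~` Fix s) H, C `<=` H & H x]].
Definition cuts_out (S : set (T -> T)) (C : set T) : Prop :=
  C = [set x | forall s, S s -> Xplus s C x].
Definition minimal_wall_set (W : set (T -> T)) (C : set T) (S : set (T -> T)) : Prop :=
  [/\ S `<=` refls W, cuts_out S C &
      forall S', S' `<=` S -> cuts_out S' C -> S' = S].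

Definition reduced_rep (S : set (T -> T)) (w : T -> T) (s : seq (T -> T)) : Prop :=
  [/\ word_in S s, wprod s = w &
      forall t, word_in S t -> wprod t = w -> (size s <= size t)%N].

Definition gallery_path (x0 : T) (s : seq (T -> T)) : set T :=
  [set x0] `|` [set z | exists2 i : nat, (i < size s)%N &
      segment (wprod (take i s) x0) (wprod (take i.+1 s) x0) z].

End Defs.

(* Main.v *)
(** A geodesic g from x0 to w x0 meets each wall at most once, since a longer
    contact with a wall could be reflected into a geodesic joining two points of
    one open half-space through the wall.  Let s be a generator whose wall g
    meets at the first time tau at which it meets any wall separating x0 from
    w x0.  Up to tau the geodesic stays in the closure of C, and g tau, being
    fixed by s, lies in the closures of both C and s C.  Applying s to the rest
    of g and recursing with s w, which has one separating wall fewer, gives a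
    word with as many letters as there are walls separating x0 from w x0; it is
    reduced because only the wall of s separates C from s C, so that no shorter
    word can cross all these walls.  Consecutive chambers of the gallery have a
    common point of g in their closures, and distance balls in a CAT(0) space
    are convex, which gives both halves of the Hausdorff bound. *)
Require Import Defs.
From HB Require Import structures.
From mathcomp Require Import all_boot all_order all_algebra.
From mathcomp Require Import boolp classical_sets functions cardinality reals ereal.
From mathcomp Require Import ring lra.
Import Order.TTheory GRing.Theory Num.Theory.
Local Open Scope classical_set_scope.
Local Open Scope ring_scope.

(** * Unit-speed paths, connectedness and components *)

Section GeodesicPaths.
Set Implicit Arguments.
Unset Strict Implicit.
Variables (R : realType) (T : Type) (d : T -> T -> R).
Hypothesis hd : is_metric d.

Lemma dist0 x : d x x = 0. Proof. by case: hd. Qed.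
Lemma dist_eq0 x y : d x y = 0 -> x = y. Proof. by case: hd => _ h _ _; exact: h. Qed.
Lemma distC x y : d x y = d y x. Proof. by case: hd. Qed.
Lemma dist_triangle y x z : d x z <= d x y + d y z. Proof. by case: hd. Qed.

Lemma dist_ge0 x y : 0 <= d x y.
Proof. by have := dist_triangle y x x; rewrite dist0 (distC y); lra. Qed.

Lemma ball_open x e : mopen d (Defs.ball d x e).
Proof.
move=> y; rewrite /Defs.ball /= => xy; exists (e - d x y); first by lra.
by move=> z /=; have := dist_triangle y x z; lra.
Qed.

Lemma mopenI A B : mopen d A -> mopen d B -> mopen d (A `&` B).
Proof.
move=> oA oB x [/oA [e e0 eA] /oB [f f0 fB]].
exists (Num.min e f); first by rewrite lt_min e0.
by move=> y; rewrite /Defs.ball /= lt_min => /andP[ye yf]; split; [exact: eA|exact: fB].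
Qed.

(** Geodesics on an arbitrary interval, so that pieces of a path need no reparametrization to start
    at time 0. *)
Definition unit_speed (g : R -> T) (a b : R) : Prop :=
  forall s t, a <= s <= b -> a <= t <= b -> d (g s) (g t) = `|s - t|.

Lemma unit_speed_sub g a b a' b' :
  unit_speed g a b -> a <= a' -> b' <= b -> unit_speed g a' b'.
Proof. by move=> hg aa bb s t hs ht; apply: hg; lra. Qed.

Lemma unit_speed_le g a b s t :
  unit_speed g a b -> a <= s -> s <= t -> t <= b -> d (g s) (g t) = t - s.
Proof. by move=> hg *; rewrite hg; [rewrite ler0_norm; lra|lra|lra]. Qed.

Lemma unit_speed_geodesic g a b : unit_speed g a b -> a <= b ->
  geodesic d (g a) (g b) (fun t => g (a + t)).
Proof.
move=> hg ab; have dab := unit_speed_le hg (lexx a) ab (lexx b).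
split; rewrite ?dab ?addr0 //; first by congr g; lra.
by move=> s t hs ht; rewrite hg; [congr (`| _ |); lra|lra|lra].
Qed.

Lemma unit_speed_geodesic_rev g a b : unit_speed g a b -> a <= b ->
  geodesic d (g b) (g a) (fun t => g (b - t)).
Proof.
move=> hg ab; have := unit_speed_le hg (lexx a) ab (lexx b); rewrite distC => dab.
split; rewrite ?dab ?subr0 //; first by congr g; lra.
by move=> s t hs ht; rewrite hg; [rewrite distrC; congr (`| _ |); lra|lra|lra].
Qed.

Lemma geodesic_unit_speed x y g : geodesic d x y g -> unit_speed g 0 (d x y).
Proof. by case. Qed.

Lemma unit_speed_segment g a b t : unit_speed g a b -> a <= t <= b ->
  segment d (g a) (g b) (g t).
Proof.
move=> hg tab; have ab : a <= b by lra.
exists (fun t => g (a + t)); split; first exact: unit_speed_geodesic.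
exists (t - a); last by congr g; lra.
by rewrite (unit_speed_le hg (lexx a) ab (lexx b)); lra.
Qed.

Lemma mconnectedU A B x : mconnected d A -> mconnected d B -> A x -> B x ->
  mconnected d (A `|` B).
Proof.
move=> cA cB Ax Bx.
suff sub U V : mopen d U -> mopen d V -> A `|` B `<=` U `|` V ->
    (A `|` B) `&` U `&` V = set0 -> U x -> (A `|` B) `&` V !=set0 -> False.
  move=> U V oU oV AB UV hU hV.
  have [Ux|Vx] := AB x (or_introl Ax); first exact: (sub U V).
  by apply: (sub V U) => //; [rewrite [V `|` U]setUC|rewrite setIAC].
move=> oU oV AB UV Ux [y [[Ay|By] Vy]].
- apply: (cA U V) => //.
  + by move=> z Az; apply: AB; left.
  + by apply/seteqP; split => // z [[Az Uz] Vz]; rewrite -UV; split=> //; split=> //; left.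
  + by exists x.
  + by exists y.
- apply: (cB U V) => //.
  + by move=> z Az; apply: AB; right.
  + by apply/seteqP; split => // z [[Az Uz] Vz]; rewrite -UV; split=> //; split=> //; right.
  + by exists x.
  + by exists y.
Qed.

Lemma mconnected_bigcup (F : set (set T)) x :
  (forall A, F A -> mconnected d A /\ A x) -> mconnected d (\bigcup_(A in F) A).
Proof.
move=> hF U V oU oV FUV UV [y [[A FA Ay] Uy]] [z [[B FB Bz] Vz]].
have [[cA Ax] [cB Bx]] := (hF A FA, hF B FB).
apply: (mconnectedU cA cB Ax Bx oU oV).
- by move=> t [At|Bt]; apply: FUV; [exists A|exists B].
- apply/seteqP; split => // t [[ABt Ut] Vt]; rewrite -UV; split=> //; split=> //.
  by case: ABt => ?; [exists A|exists B].
- by exists y; split=> //; left.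
- by exists z; split=> //; right.
Qed.

Lemma mconnected1 x : mconnected d [set x].
Proof.
by move=> U V _ _ _ UV [y [-> Ux]] [z [-> Vx]]; suff : set0 x by []; rewrite -UV.
Qed.

Lemma component_exists A x : A x -> exists2 H, component_of d A H & H x.
Proof.
move=> Ax; pose F := [set D | [/\ mconnected d D, D x & D `<=` A]].
have cF : mconnected d (\bigcup_(D in F) D).
  by apply: (@mconnected_bigcup _ x) => D [].
have Fx : F [set x] by split=> //; [exact: mconnected1|move=> y ->].
exists (\bigcup_(D in F) D); last by exists [set x].
split=> //.
- by move=> y [D [_ _ DA] Dy]; exact: DA.
- by exists x; exists [set x].
- move=> D cD FD DA; apply/seteqP; split=> // y Dy; exists D => //.
  by split=> //; apply: FD; exists [set x].
Qed.

Lemma component_eq A H H' x : component_of d A H -> component_of d A H' ->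
  H x -> H' x -> H = H'.
Proof.
move=> [HA _ cH mH] [H'A _ cH' mH'] Hx H'x.
have cU := mconnectedU cH cH' Hx H'x.
have UA : H `|` H' `<=` A by move=> y [/HA|/H'A].
have e1 : H `|` H' = H by apply: mH => // y; left.
by rewrite -e1; apply: mH' => // y; right.
Qed.

Lemma component_absorb A H D x : component_of d A H -> mconnected d D ->
  D `<=` A -> H x -> D x -> D `<=` H.
Proof.
move=> [HA _ cH mH] cD DA Hx Dx y Dy.
suff <- : H `|` D = H by right.
apply: mH; first exact: (mconnectedU cH cD Hx Dx).
- by move=> z; left.
- by move=> z [/HA|/DA].
Qed.

(** At the supremum [sg] of the times in [[al, be]] at which [g] is in [U], openness of [U] would
    push the supremum further, and openness of [V] would put a point of [E] into both sets. *)
Lemma unit_speed_connected g a b : unit_speed g a b ->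
  mconnected d (g @` [set t | a <= t <= b]).
Proof.
move=> hg.
suff sub U V : mopen d U -> mopen d V ->
    (forall t, a <= t <= b -> U (g t) \/ V (g t)) ->
    (forall t, a <= t <= b -> U (g t) -> V (g t) -> False) ->
    forall al be, a <= al <= b -> a <= be <= b -> al <= be ->
      U (g al) -> V (g be) -> False.
  move=> U V oU oV cov dis [_ [[al hal <-] Ual]] [_ [[be hbe <-] Vbe]].
  have cov' t : a <= t <= b -> U (g t) \/ V (g t).
    by move=> ht; apply: cov; exists t.
  have dis' t : a <= t <= b -> U (g t) -> V (g t) -> False.
    by move=> ht Ut Vt; suff : set0 (g t) by []; rewrite -dis; split=> //; split=> //; exists t.
  have [le|/ltW le] := leP al be; first exact: (sub U V _ _ _ _ al be).
  apply: (sub V U _ _ _ _ be al) => //; first by move=> t /cov' [|]; [right|left].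
  by move=> t /dis' h Vt Ut; exact: h.
move=> oU oV cov dis al be hal hbe le Ual Vbe.
pose E := [set t | al <= t <= be /\ U (g t)]; pose sg := sup E.
have Eal : E al by split=> //; rewrite lexx.
have ubE : has_ubound E by exists be => t [/andP[]].
have supE : has_sup E by split=> //; exists al.
have al_sg : al <= sg by exact: ub_le_sup.
have sg_be : sg <= be by apply: ge_sup; [exists al|move=> t [/andP[]]].
have sgab : a <= sg <= b by lra.
have [Us|Vs] := cov sg sgab.
- have [e e0 eU] := oU _ Us.
  have sg_lt : sg < be.
    rewrite lt_neqAle sg_be andbT; apply/eqP => sgE.
    by apply: (dis sg) => //; rewrite sgE.
  pose t := Num.min be (sg + e / 2).
  have t1 : sg < t by rewrite lt_min sg_lt; lra.
  have t2 : t <= be by rewrite ge_min lexx.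
  have t3 : t <= sg + e / 2 by rewrite ge_min lexx orbT.
  have Et : E t.
    split; first by lra.
    by apply: eU; rewrite /Defs.ball /= (unit_speed_le hg); lra.
  by have := ub_le_sup ubE Et; rewrite -/sg; lra.
- have [e e0 eV] := oV _ Vs.
  have [t Et te] := sup_adherent e0 supE.
  have tsg : t <= sg by exact: ub_le_sup.
  have [htb Ut] := Et; apply: (dis t) => //; first by lra.
  by apply: eV; rewrite /Defs.ball /= distC (unit_speed_le hg); move: te; rewrite -/sg; lra.
Qed.

Hypothesis hgeo : geodesic_space d.

(** A geodesic from the centre of a ball stays in the ball and is connected, so it cannot leave the
    component. *)
Lemma component_open A H : mopen d A -> component_of d A H -> mopen d H.
Proof.
move=> oA cH x Hx; have HA : H `<=` A by case: cH.
have [e e0 eA] := oA _ (HA _ Hx); exists e => // y xy.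
have [g gxy] := hgeo x y; have [g0 gd _] := gxy.
have hg := geodesic_unit_speed gxy.
have dxy := dist_ge0 x y.
apply: (component_absorb cH (unit_speed_connected hg) _ Hx).
- move=> _ [t /= ht <-]; apply: eA; rewrite /Defs.ball /= in xy *.
  by rewrite -{1}g0 (unit_speed_le hg); lra.
- by exists 0; rewrite /= ?lexx.
- by exists (d x y); rewrite /= ?lexx ?dxy.
Qed.

End GeodesicPaths.

(** * CAT(0) geometry: uniqueness, convex balls, gluing *)

Section CAT0Geometry.
Set Implicit Arguments.
Unset Strict Implicit.
Variables (R : realType) (T : Type) (d : T -> T -> R).
Hypotheses (hd : is_metric d) (hcat : CAT0 d).

(** Comparison with the triangle [x, y, y], whose third side is 0: at equal times the Euclidean
    bound vanishes. *)
Lemma geodesic_unique x y g g' t : geodesic d x y g -> geodesic d x y g' ->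
  0 <= t <= d x y -> g t = g' t.
Proof.
move=> hg hg' ht; have [_ hC] := hcat.
have [dxy|dxy] := leP (d x y) 0.
  have -> : t = 0 by lra.
  by case: hg => -> _ _; case: hg' => ->.
apply: (dist_eq0 hd); apply/eqP; rewrite -sqrf_eq0; apply/eqP/le_anti.
rewrite sqr_ge0 andbT.
have := hC _ _ _ _ _ _ _ hg hg' dxy dxy ht ht; rewrite (dist0 hd).
suff -> : t ^+ 2 + t ^+ 2 - t * t * (d x y ^+ 2 + d x y ^+ 2 - 0 ^+ 2) /
  (d x y * d x y) = 0 by [].
by field; rewrite gt_eqF.
Qed.

(** Convexity of balls: comparison at the vertex [y1] bounds the squared distance to [p] by a convex
    combination of its values at the ends. *)
Lemma dist_segment_le p y1 y2 z D : d p y1 <= D -> d p y2 <= D ->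
  segment d y1 y2 z -> d p z <= D.
Proof.
move=> h1 h2 [gy [hy [s hs <-]]]; have [hgeo hC] := hcat.
have [b0|b0] := leP (d y1 y2) 0.
  have -> : s = 0 by lra.
  by case: hy => ->.
have [c0|c0] := leP (d y1 p) 0.
  have yp : y1 = p by apply: (dist_eq0 hd); have := dist_ge0 hd y1 p; lra.
  case: (hy) => gy0 _ _; have := unit_speed_le (geodesic_unit_speed hy).
  move=> /(_ 0 s); rewrite gy0 -yp => ->; try lra.
  by move: h2; rewrite -yp; lra.
have [gz hz] := hgeo y1 p.
have hc : 0 <= d y1 p <= d y1 p by rewrite lexx ltW.
have := hC _ _ _ _ _ _ _ hy hz b0 c0 hs hc; case: (hz) => _ -> _.
rewrite (distC hd (gy s)) => h.
have D0 : 0 <= D by have := dist_ge0 hd p y1; lra.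
rewrite -ler_sqr ?nnegrE ?(dist_ge0 hd) //; apply: (le_trans h).
set b := d y1 y2 in hs b0 h *; rewrite (distC hd y1 p) in c0 h *.
rewrite (distC hd y2 p); set c := d p y1 in h1 c0 h *; set a := d p y2 in h2 h *.
have a0 : 0 <= a by exact: (dist_ge0 hd).
pose l := s / b; have sE : s = l * b by rewrite /l divfK // gt_eqF.
have l0 : 0 <= l by rewrite /l divr_ge0 //; lra.
have l1 : l <= 1 by rewrite /l ler_pdivrMr //; lra.
(* Stewart's formula: the law-of-cosines bound in terms of the ratio [l = s / b]. *)
have -> : s ^+ 2 + c ^+ 2 - s * c * (b ^+ 2 + c ^+ 2 - a ^+ 2) / (b * c) =
    (1 - l) * c ^+ 2 + l * a ^+ 2 - l * (1 - l) * b ^+ 2.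
  by rewrite sE; field; rewrite !gt_eqF.
have c2 : c ^+ 2 <= D ^+ 2 by rewrite ler_sqr ?nnegrE //; lra.
have a2 : a ^+ 2 <= D ^+ 2 by rewrite ler_sqr ?nnegrE //; lra.
have e1 : (1 - l) * c ^+ 2 <= (1 - l) * D ^+ 2 by apply: ler_wpM2l => //; lra.
have e2 : l * a ^+ 2 <= l * D ^+ 2 by apply: ler_wpM2l.
have e3 : 0 <= l * (1 - l) * b ^+ 2.
  by apply: mulr_ge0; [apply: mulr_ge0 => //; lra|exact: sqr_ge0].
lra.
Qed.

(* Two geodesic pieces that overlap around their junction meet at angle pi
   there, and the CAT(0) inequality turns this into the full distance b - a. *)
Lemma unit_speed_glue g a b m e : 0 < e -> a <= m - e -> m + e <= b ->
  unit_speed d g a m -> unit_speed d g m b ->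
  d (g (m - e)) (g (m + e)) = e *+ 2 -> unit_speed d g a b.
Proof.
move=> e0 am mb g1 g2 ge; have [_ hC] := hcat.
have am' : a <= m by lra.
have mb' : m <= b by lra.
have dA := unit_speed_le g1 (lexx a) am' (lexx m).
have dB := unit_speed_le g2 (lexx m) mb' (lexx b).
have hA := unit_speed_geodesic_rev hd g1 am'.
have hB := unit_speed_geodesic g2 mb'.
rewrite (distC hd) in dA.
have ends : b - a <= d (g a) (g b).
  have := hC _ _ _ _ _ e e hA hB; rewrite ge dA dB.
  move=> /(_ ltac:(lra) ltac:(lra) ltac:(lra) ltac:(lra)) h.
  have dge := dist_ge0 hd (g a) (g b).
  set A := m - a in h; set B := b - m in h; set D := d (g a) (g b) in h dge *.
  have A0 : 0 < A by rewrite /A; lra.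
  have B0 : 0 < B by rewrite /B; lra.
  have AB0 : 0 < A * B by rewrite mulr_gt0.
  (* The comparison cosine at [g m] is at most -1: with both sides equal to [e], the left-hand side
     is already [4 e^2]. *)
  have k : (A ^+ 2 + B ^+ 2 - D ^+ 2) / (A * B) <= - 2.
    have ee : 0 < e * e by rewrite mulr_gt0.
    rewrite -(ler_pM2l ee).
    have e4 : (e *+ 2) ^+ 2 = 4 * (e * e) by ring.
    by move: h; rewrite e4 -[X in _ - X]mulrA; lra.
  have : (A + B) ^+ 2 <= D ^+ 2 by move: k; rewrite ler_pdivrMr //; lra.
  rewrite ler_sqr ?nnegrE //; last by rewrite addr_ge0 // ltW.
  by rewrite /A /B; lra.
suff sub s t : a <= s -> s <= t -> t <= b -> d (g s) (g t) = t - s.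
  move=> s t hs ht; have [st|ts] := leP s t.
    by rewrite sub ?ler0_norm; lra.
  by rewrite (distC hd) sub ?gtr0_norm; lra.
move=> as_ st tb.
have [tm|mt] := leP t m; first exact: (unit_speed_le g1).
have [sm|ms] := leP s m; last by apply: (unit_speed_le g2); lra.
(* Ends at full distance leave no slack in the triangle inequalities along [a <= s <= t <= b]. *)
have t1 := dist_triangle hd (g s) (g a) (g b).
have t2 := dist_triangle hd (g t) (g s) (g b).
have t3 := dist_triangle hd (g m) (g s) (g t).
have e1 : d (g a) (g s) = s - a by apply: (unit_speed_le g1).
have e2 : d (g t) (g b) = b - t by apply: (unit_speed_le g2); lra.
have e3 : d (g s) (g m) = m - s by apply: (unit_speed_le g1).
have e4 : d (g m) (g t) = t - m by apply: (unit_speed_le g2); lra.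
lra.
Qed.

Lemma unit_speed_comp f g a b : (forall x y, d (f x) (f y) = d x y) ->
  unit_speed d g a b -> unit_speed d (f \o g) a b.
Proof. by move=> hf hg s t hs ht /=; rewrite hf hg. Qed.

(** [r \o g] is a geodesic with the same ends as [g], so the two agree by uniqueness. *)
Lemma fix_between r g a b t : (forall x y, d (r x) (r y) = d x y) ->
  unit_speed d g a b -> r (g a) = g a -> r (g b) = g b -> a <= t <= b ->
  r (g t) = g t.
Proof.
move=> hr hg ra rb ht; have ab : a <= b by lra.
have := unit_speed_geodesic (unit_speed_comp hr hg) ab; rewrite /= ra rb => h.
have := geodesic_unique h (unit_speed_geodesic hg ab) => /(_ (t - a)) /=.
have -> : a + (t - a) = t by ring.
by rewrite (unit_speed_le hg (lexx a) ab (lexx b)); apply; lra.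
Qed.

Lemma convex_unit_speed H g a b t : convex d H -> unit_speed d g a b ->
  a <= t <= b -> H (g a) -> H (g b) -> H (g t).
Proof. by move=> cH hg ht Ha Hb; apply: (cH _ _ Ha Hb); exact: (unit_speed_segment hg). Qed.

(* If a geodesic met Fix r along an interval, reflecting its second half about
   the middle of that interval would give a geodesic with both ends in H. *)
Lemma fix_at_most_once r H g a b t1 t2 :
  (forall x y, d (r x) (r y) = d x y) -> convex d H ->
  (forall y, H y -> r y <> y) -> unit_speed d g a b -> H (g a) ->
  H (r (g b)) -> a <= t1 <= b -> a <= t2 <= b -> r (g t1) = g t1 ->
  r (g t2) = g t2 -> t1 = t2.
Proof.
move=> hr cH Hr hg Ha Hb h1 h2 r1 r2.
suff sub u v : a <= u <= b -> a <= v <= b -> r (g u) = g u -> r (g v) = g v ->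
    u < v -> False.
  by case: (ltgtP t1 t2) => // [/(sub t1 t2 h1 h2 r1 r2)|/(sub t2 t1 h2 h1 r2 r1)].
move=> {t1 t2 h1 h2 r1 r2} hu hv ru rv uv.
pose m := (u + v) / 2; pose e := (v - u) / 2.
have rm : r (g m) = g m.
  apply: (fix_between hr _ ru rv); last by rewrite /m; lra.
  by apply: unit_speed_sub hg _ _; lra.
pose g' t := if t <= m then g t else r (g t).
have g'1 t : t <= m -> g' t = g t by rewrite /g' => ->.
have g'2 t : m <= t -> g' t = r (g t).
  by rewrite le_eqVlt => /predU1P[<-|mt]; rewrite /g' ?lexx // leNgt mt.
have hg' : unit_speed d g' a b.
  apply: (@unit_speed_glue g' a b m e); rewrite /m /e; try lra.
  - by move=> s t hs ht; rewrite !g'1 ?hg // /m; lra.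
  - by move=> s t hs ht; rewrite !g'2 ?hr ?hg // /m; lra.
  - rewrite g'1 ?g'2; rewrite /m; try lra.
    have -> : (u + v) / 2 + (v - u) / 2 = v by lra.
    have -> : (u + v) / 2 - (v - u) / 2 = u by lra.
    by rewrite rv (unit_speed_le hg); lra.
apply: (Hr (g m)) => //; rewrite -g'1 //.
apply: (convex_unit_speed cH hg'); first by rewrite /m; lra.
- by rewrite g'1 // /m; lra.
- by rewrite g'2 // /m; lra.
Qed.

End CAT0Geometry.

(** * Transport along isometries and conjugation of reflections *)

Section IsometricTransfer.
Set Implicit Arguments.
Unset Strict Implicit.
Variables (R : realType) (T : Type) (d : T -> T -> R).

Lemma mopen_preimage f U : (forall x y, d (f x) (f y) = d x y) ->
  mopen d U -> mopen d (f @^-1` U).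
Proof.
move=> hf oU x Ux; have [e e0 eU] := oU _ Ux; exists e => // y xy.
by apply: eU; rewrite /Defs.ball /= hf.
Qed.

Lemma mconnected_image f A : (forall x y, d (f x) (f y) = d x y) ->
  mconnected d A -> mconnected d (f @` A).
Proof.
move=> hf cA U V oU oV AUV UV [_ [[x Ax <-] Ux]] [_ [[y Ay <-] Vy]].
apply: (cA _ _ (mopen_preimage hf oU) (mopen_preimage hf oV)).
- by move=> z Az; apply: AUV; exists z.
- apply/seteqP; split => // z [[Az Uz] Vz]; suff : set0 (f z) by [].
  by rewrite -UV; split=> //; split=> //; exists z.
- by exists x.
- by exists y.
Qed.

Lemma segment_image f x y z : (forall x y, d (f x) (f y) = d x y) ->
  segment d x y z -> segment d (f x) (f y) (f z).
Proof.
move=> hf [g [[g0 g1 hg] [t ht <-]]]; exists (f \o g); split; last first.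
  by exists t; rewrite ?hf.
by split; rewrite ?hf /= ?g0 ?g1 // => s u hs hu; rewrite hf hg.
Qed.

Lemma convex_image f f' A : (forall x y, d (f' x) (f' y) = d x y) ->
  cancel f f' -> cancel f' f -> convex d A -> convex d (f @` A).
Proof.
move=> hf' fK f'K cA _ _ [x Ax <-] [y Ay <-] z hz; exists (f' z) => //.
by apply: (cA x y) => //; have := segment_image hf' hz; rewrite !fK.
Qed.

Lemma imageK (f f' : T -> T) (A : set T) : cancel f' f -> f @` (f' @` A) = A.
Proof.
move=> f'K; apply/seteqP; split=> [_ [_ [x Ax <-] <-]|x Ax]; first by rewrite f'K.
by exists (f' x); [exists x|rewrite f'K].
Qed.

Lemma component_image f f' A H : (forall x y, d (f x) (f y) = d x y) ->
  (forall x y, d (f' x) (f' y) = d x y) -> cancel f f' -> cancel f' f ->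
  component_of d A H -> component_of d (f @` A) (f @` H).
Proof.
move=> hf hf' fK f'K [HA [x Hx] cH mH]; split.
- by move=> _ [y /HA Ay <-]; exists y.
- by exists (f x), x.
- exact: mconnected_image.
move=> D cD HD DA; have DE : f' @` D = H.
  apply: mH; first exact: mconnected_image.
    by move=> y Hy; exists (f y) => //; apply: HD; exists y.
  by move=> _ [y /DA[z Az <-] <-]; rewrite fK.
by rewrite -DE imageK.
Qed.

Lemma Fix_conj (f f' r : T -> T) : cancel f f' -> cancel f' f ->
  Fix (f \o r \o f') = f @` Fix r.
Proof.
move=> fK f'K; apply/seteqP; split=> [x /= hx|_ [x hx <-]].
  by exists (f' x); rewrite // /Fix /= -[in RHS]hx /= fK.
by rewrite /Fix /= fK hx.
Qed.

Lemma reflection_conj f f' r : Defs.isometry d f -> Defs.isometry d f' ->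
  cancel f f' -> cancel f' f -> reflection d r ->
  reflection d (f \o r \o f').
Proof.
move=> [hf bf] [hf' bf'] fK f'K [[hr br] rr nint [H1 [H2 [H12 c1 c2 only]]]].
move=> [cv1 cv2 r1 r2].
have FixE := Fix_conj r fK f'K.
have CE : ~` Fix (f \o r \o f') = f @` (~` Fix r).
  apply/seteqP; split=> [x hx|_ [x hx <-]].
    by exists (f' x) => // /= h; apply: hx; rewrite FixE; exists (f' x).
  by rewrite FixE => -[y hy /(can_inj fK) yx]; apply: hx; rewrite -yx.
have imI : injective (fun A : set T => f @` A).
  by apply: (can_inj (g := fun A => f' @` A)) => A; rewrite imageK.
have swap H H' : r @` H = H' -> (f \o r \o f') @` (f @` H) = f @` H'.
  move=> <-; apply/seteqP; split=> [_ [_ [x Hx <-] <-]|_ [_ [x Hx <-] <-]].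
    by exists (r x); rewrite /= ?fK //; exists x.
  by exists (f x); rewrite /= ?fK //; exists x.
split.
- split; first by move=> x y; rewrite /= hf hr hf'.
  exact: bij_comp (bij_comp bf br) bf'.
- by apply/funext => x /=; rewrite fK -[r (r _)]/((r \o r) _) rr f'K.
- move=> [x [e e0 sub]]; apply: nint; exists (f' x), e => // y.
  rewrite /Defs.ball /= => xy; have : Fix (f \o r \o f') (f y).
    by apply: sub; rewrite /Defs.ball /= -[x]f'K hf.
  by rewrite FixE => -[z hz /(can_inj fK) <-].
- exists (f @` H1), (f @` H2); rewrite CE; split.
  + by move/imI.
  + exact: (component_image hf hf').
  + exact: (component_image hf hf').
  + move=> H /(component_image hf' hf f'K fK).
    by rewrite imageK // => /only[] <-; rewrite imageK //; [left|right].
  + by split; [exact: (convex_image hf')|exact: (convex_image hf')|exact: swap|exact: swap].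
Qed.

End IsometricTransfer.

(** * Half-spaces of a reflection *)

Section Sides.
Set Implicit Arguments.
Unset Strict Implicit.
Variables (R : realType) (T : Type) (d : T -> T -> R).
Hypotheses (hd : is_metric d) (hgeo : geodesic_space d).

(** Records what the later arguments need of an open half-space of [r]; the last two clauses say
    that [P] and its mirror image partition the complement of the wall. *)
Definition is_side (r : T -> T) (P : set T) : Prop :=
  [/\ mopen d P, convex d P, forall x, P x -> r x <> x,
      forall x, P x -> ~ P (r x) & forall x, r x <> x -> P x \/ P (r x)].

Lemma reflection_dist r x y : reflection d r -> d (r x) (r y) = d x y.
Proof. by case=> -[]. Qed.

Lemma reflectionK r : reflection d r -> involutive r.
Proof. by case=> _ rr _ _ x; rewrite -[LHS]/((r \o r) x) rr. Qed.

Lemma component_is_side r H1 H2 : reflection d r ->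
  component_of d (~` Fix r) H1 -> component_of d (~` Fix r) H2 -> H1 <> H2 ->
  (forall H, component_of d (~` Fix r) H -> H = H1 \/ H = H2) ->
  convex d H1 -> r @` H1 = H2 -> is_side r H1.
Proof.
move=> hr c1 c2 H12 only cv1 r1; have rK := reflectionK hr.
have hr' x y : d (r x) (r y) = d x y by exact: reflection_dist.
(* The wall is closed: a fixed point [y] forces [x] to move by at most [2 * d x y]. *)
have oF : mopen d (~` Fix r).
  move=> x hx; have dx : 0 < d x (r x).
    rewrite lt_neqAle (dist_ge0 hd) andbT; apply/eqP => /esym/(dist_eq0 hd) h.
    exact: hx.
  exists (d x (r x) / 2); first by lra.
  move=> y; rewrite /Defs.ball /= => xy ry.
  have := dist_triangle hd y x (r x); rewrite -{2}ry hr' (distC hd y); lra.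
have H1r x : H1 x -> H2 (r x) by move=> h; rewrite -r1; exists x.
have H2r x : H2 x -> H1 (r x) by rewrite -r1 => -[y h <-]; rewrite rK.
split=> //.
- exact: (component_open hd hgeo oF c1).
- by case: c1 => sub _ _ _ x /sub.
- by move=> x /H1r h h'; apply: H12; exact: (component_eq c1 c2 h' h).
- move=> x hx; have [H cH Hx] := component_exists d (hx : (~` Fix r) x).
  by have [HE|HE] := only _ cH; rewrite HE in Hx; [left|right; exact: H2r].
Qed.

Lemma Xplus_is_side r C x : reflection d r -> mconnected d C -> C x ->
  C `<=` ~` Fix r -> is_side r (Xplus d r C) /\ C `<=` Xplus d r C.
Proof.
move=> hr cC Cx CF; have rK := reflectionK hr.
have [H [H' [cH cH' HH' only [cvH rH]]] CH] : exists H, exists2 H',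
    [/\ component_of d (~` Fix r) H, component_of d (~` Fix r) H', H <> H',
    forall K, component_of d (~` Fix r) K -> K = H \/ K = H' &
    convex d H /\ r @` H = H'] & C `<=` H.
  case: hr => _ _ _ [H1 [H2 [H12 c1 c2 only [cv1 cv2 r1 r2]]]].
  have [K cK Kx] := component_exists d (CF _ Cx).
  have CK := component_absorb cK cC CF Kx Cx.
  case: (only _ cK) => KE; rewrite KE in CK.
    by exists H1, H2.
  exists H2, H1 => //; split=> //; first exact: nesym.
  by move=> A /only[]; [right|left].
have -> : Xplus d r C = H.
  apply/seteqP; split=> [y [K [cK CK Ky]]|y Hy]; last by exists H.
  by rewrite (component_eq cH cK (CH _ Cx) (CK _ Cx)).
by split=> //; exact: (component_is_side hr cH cH').
Qed.

(** The image of [g] is connected and covered by the disjoint open sets [P] and its preimage under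
    [r]. *)
Lemma side_path r P g a b s t : reflection d r -> is_side r P ->
  unit_speed d g a b -> (forall u, a <= u <= b -> r (g u) <> g u) ->
  a <= s <= b -> a <= t <= b -> P (g s) -> P (g t).
Proof.
move=> hr [oP _ _ PN Por] hg nfix hs ht Ps; have rK := reflectionK hr.
have [//|Pt] := Por _ (nfix _ ht); exfalso.
have oP' : mopen d (r @^-1` P).
  by apply: mopen_preimage oP => x y; exact: reflection_dist hr.
apply: (unit_speed_connected hd hg oP oP').
- by move=> _ [u hu <-]; exact: Por (nfix _ hu).
- by apply/seteqP; split=> // y [[_ /PN h] /h].
- by exists (g s); split=> //; exists s.
- by exists (g t); split=> //; exists t.
Qed.

Lemma side_segment r P x y : reflection d r -> is_side r P ->
  (forall z, segment d x y z -> r z <> z) -> P x -> P y.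
Proof.
move=> hr hP nfix Px; have [g hg] := hgeo x y; case: (hg) => g0 gd _.
have dxy := dist_ge0 hd x y.
have h := @side_path r P g 0 (d x y) 0 (d x y) hr hP (geodesic_unit_speed hg).
rewrite g0 gd in h; apply: h => //; rewrite ?lexx ?dxy //.
by move=> u hu; apply: nfix; exists g; split=> //; exists u.
Qed.

Lemma ball_same_side r P x y e : reflection d r -> is_side r P ->
  (forall z, d x z < e -> r z <> z) -> d x y < e -> P x <-> P y.
Proof.
move=> hr hP nfix xy.
have sub z : segment d x y z -> d x z < e.
  move=> [g [hg [t ht <-]]]; case: (hg) => g0 _ _.
  by rewrite -{1}g0 (unit_speed_le (geodesic_unit_speed hg)); lra.
split; first by apply: (side_segment hr hP) => z /sub/nfix.
apply: (side_segment hr hP) => z [g [hg [t ht <-]]]; apply: nfix.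
case: (hg) => _ gd _; rewrite (distC hd) -[in X in d _ X]gd.
by rewrite (unit_speed_le (geodesic_unit_speed hg)) ?lexx; move: xy; rewrite (distC hd); lra.
Qed.

End Sides.

(** * Extremal values over finite lists *)

Lemma seq_argmin {R : realType} {A : eqType} (f : A -> R) (x : A) (s : seq A) :
  exists2 y, y \in x :: s & forall z, z \in x :: s -> f y <= f z.
Proof.
elim: s x => [|x' s IH] x.
  by exists x; rewrite ?mem_head // => z; rewrite inE => /eqP->.
have [y ys hy] := IH x'.
have [xy|yx] := leP (f x) (f y).
  exists x; first exact: mem_head.
  by move=> z; rewrite inE => /predU1P[->//|/hy]; exact: le_trans.
exists y; first by rewrite inE ys orbT.
by move=> z; rewrite inE => /predU1P[->|/hy//]; exact: ltW.
Qed.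

Lemma positive_lower_bound {R : realType} {A : eqType} (f : A -> R) (s : seq A) :
  exists2 e : R, 0 < e & forall x, x \in s -> 0 < f x -> e < f x.
Proof.
elim: s => [|x s [e e0 IH]]; first by exists 1.
exists (if 0 < f x then Num.min e (f x / 2) else e).
  by case: ifP => // fx; rewrite lt_min e0; lra.
move=> y; rewrite inE => /predU1P[->|ys] fy.
  by rewrite fy gt_min; apply/orP; right; lra.
by apply: le_lt_trans (IH y ys fy); case: ifP => // _; rewrite ge_min lexx.
Qed.

(** * Walls, chambers and panels of the group *)

Section ReflectionGroups.
Set Implicit Arguments.
Unset Strict Implicit.
Variables (R : realType) (T : Type) (d : T -> T -> R).
Hypotheses (hd : is_metric d) (hcat : CAT0 d).
Variable W : set (T -> T).
Hypotheses (hW : reflection_group d W) (hprop : acts_properly d W).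
Variable C : set T.
Hypotheses (hC : chamber d W C) (hcc : cocompact_discrete d W C).
Variable S : set (T -> T).
Hypothesis hS : minimal_wall_set d W C S.
Variable x0 : T.
Hypothesis hx0 : C x0.

Let hgeo : geodesic_space d. Proof. by case: hcat. Qed.

Lemma W_dist w : W w -> forall x y, d (w x) (w y) = d x y.
Proof. by case: hW => _ _ _ h _ /h[]. Qed.

Lemma W_comp f g : W f -> W g -> W (f \o g).
Proof. by case: hW => _ h _ _ _; exact: h. Qed.

Lemma W_inv w : W w -> exists w', [/\ W w', cancel w w' & cancel w' w].
Proof.
case: hW => _ _ h _ _ /h[w' Ww' [h1 h2]]; exists w'; split=> // x.
  by rewrite -[LHS]/((w' \o w) x) h1.
by rewrite -[LHS]/((w \o w') x) h2.
Qed.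

Lemma refls_conj u v r : W u -> W v -> cancel u v -> cancel v u ->
  refls d W r -> refls d W (u \o r \o v).
Proof.
move=> Wu Wv uK vK [Wr hr]; split; first by apply: W_comp => //; apply: W_comp.
by case: hW => _ _ _ h _; apply: reflection_conj => //; exact: h.
Qed.

Lemma refls_conjJ s r : refls d W s -> refls d W r -> refls d W (s \o r \o s).
Proof. by move=> [Ws /reflectionK sK]; apply: refls_conj. Qed.

Lemma chamber_off_walls r x : refls d W r -> C x -> r x <> x.
Proof. by case: hC => sub _ _ _ hr /sub h rx; apply: h; exists r. Qed.

Lemma Xplus_side r : refls d W r ->
  is_side d r (Xplus d r C) /\ C `<=` Xplus d r C.
Proof.
move=> hr; case: (hC) => _ _ cC _; apply: (Xplus_is_side hd hgeo _ cC hx0).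
  by case: hr.
by move=> x Cx; exact: chamber_off_walls.
Qed.

Lemma S_refls s : S s -> refls d W s. Proof. by case: hS => h _ _ /h. Qed.

Lemma chamber_of_sides x : (forall s, S s -> Xplus d s C x) -> C x.
Proof. by case: hS => _ CE _ h; rewrite CE. Qed.

Lemma chamber_convex : convex d C.
Proof.
move=> x y Cx Cy z hz; apply: chamber_of_sides => s /S_refls/Xplus_side[hP CP].
by case: hP => _ cv _ _ _; exact: (cv x y (CP _ Cx) (CP _ Cy)).
Qed.

(** A reflection fixing [w x] would be conjugate by [w] to a reflection of [W] fixing [x]. *)
Lemma orbit_off_walls w r x : W w -> refls d W r -> C x -> r (w x) <> w x.
Proof.
move=> Ww hr Cx rwx; have [w' [Ww' wK w'K]] := W_inv Ww.
apply: (@chamber_off_walls (w' \o r \o w) x) => //; first exact: refls_conj.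
by rewrite /= rwx wK.
Qed.

(** A reflection whose wall passes near [x] moves [x] little; properness leaves finitely many of
    these, and below their least positive displacement only walls through [x] remain. *)
Lemma walls_locally_finite x : exists2 e : R, 0 < e &
  forall r y, refls d W r -> d x y < e -> r y = y -> r x = x.
Proof.
have [s sE] := (@finite_seqP {classic (T -> T)} _).1 (hprop x ltr01).
have [e e0 he] :=
  positive_lower_bound (fun g : {classic (T -> T)} => d x ((g : T -> T) x)) s.
(* The displacement is at most twice the radius: [1 / 2] keeps it below 1, the radius given to
   [hprop], and [e / 2] below [e]. *)
exists (Num.min (e / 2) (1 / 2)); first by rewrite lt_min; apply/andP; split; lra.
move=> r y hr; rewrite lt_min => /andP[xy xy1] ry; have [Wr _] := hr.
have xrx : d x (r x) <= 2 * d x y.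
  have := dist_triangle hd y x (r x); rewrite -{2}ry W_dist // (distC hd y).
  by lra.
apply/esym/(dist_eq0 hd)/le_anti; rewrite (dist_ge0 hd) andbT leNgt; apply/negP => rx.
have rs : (r : {classic (T -> T)}) \in s.
  suff : [set` s] r by [].
  by rewrite -sE; split=> //; rewrite /Defs.ball /=; lra.
by have := he _ rs rx; lra.
Qed.

(** The image of [C] is convex and off all walls, so a single common point puts it inside [C]; the
    inverse gives equality, and the stabilizer of [C] is trivial. *)
Lemma chamber_fix w x : W w -> C x -> C (w x) -> w = id.
Proof.
have sub u z : W u -> C z -> C (u z) -> forall q, C q -> C (u q).
  move=> Wu Cz Cuz q Cq; apply: chamber_of_sides => s /S_refls hs.
  have [hP CP] := Xplus_side hs; have [u' [Wu' uK u'K]] := W_inv Wu.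
  apply: (side_segment hd hgeo _ hP _ (CP _ Cuz)); first by case: hs.
  move=> y hy; have := segment_image (W_dist Wu') hy; rewrite !uK => hy'.
  rewrite -[y]u'K; apply: orbit_off_walls => //; exact: chamber_convex hy'.
move=> Ww Cx Cwx; have [w' [Ww' wK w'K]] := W_inv Ww.
case: hcc => _; apply=> //; apply/seteqP; split=> [_ [y Cy <-]|y Cy].
  exact: (sub w x).
by exists (w' y); rewrite ?w'K //; apply: (sub w' (w x)) => //; rewrite wK.
Qed.

Lemma chamber_closure_side r x : refls d W r -> mclosure d C x ->
  r x <> x -> Xplus d r C x.
Proof.
move=> hr Cx rx; have [[oP _ _ PN Por] CP] := Xplus_side hr.
have [//|Pr] := Por _ rx; exfalso.
have oP' : mopen d (r @^-1` Xplus d r C).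
  by apply: mopen_preimage oP; apply: W_dist; case: hr.
have [e e0 sub] := oP' _ Pr; have [y Cy xy] := Cx e e0.
exact: (PN y (CP _ Cy) (sub _ xy)).
Qed.

(* A point p on the wall of s, strictly inside all the other half-spaces,
   exists by minimality of S; near p the only chambers are C and s C, so any
   r fixing p has s o r mapping a point of C into C. *)
Lemma generator_panel s : S s -> exists p, exists2 e : R, 0 < e &
  [/\ s p = p, forall y, d p y < e -> Xplus d s C y -> C y &
  forall r y, refls d W r -> r <> s -> d p y < e -> r y <> y].
Proof.
move=> Ss; have hs := S_refls Ss; have [hP CP] := Xplus_side hs.
(* Minimality of [S]: otherwise the generators other than [s] would already cut out [C]. *)
have [y Py nPy] : exists2 y, forall t, S t -> t <> s -> Xplus d t C y &
    ~ Xplus d s C y.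
  apply: contrapT => h; case: hS => _ _ /(_ [set t | S t /\ t <> s]) hmin.
  suff SE : [set t | S t /\ t <> s] = S by have := Ss; rewrite -SE => -[_].
  apply: hmin; first by move=> t [].
  apply/seteqP; split=> [x Cx t [/S_refls/Xplus_side[_ sub] _]|x hx].
    exact: sub.
  apply: chamber_of_sides => t St; have [ts|ts] := pselect (t = s).
    rewrite ts; apply: contrapT => nP; apply: h; exists x => // t' St' ts'.
    exact: hx.
  by apply: hx.
(* [p] is where the segment from [x0] to [y] crosses the wall of [s]; convexity keeps it in the
   other half-spaces. *)
have [p sp pP] : exists2 p, s p = p & forall t, S t -> t <> s -> Xplus d t C p.
  apply: contrapT => h; apply: nPy.
  apply: (side_segment hd hgeo _ hP _ (CP _ hx0)); first by case: hs.
  move=> z hz sz; apply: h; exists z => // t St ts.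
  have [[_ cv _ _ _] sub] := Xplus_side (S_refls St).
  exact: (cv _ _ (sub _ hx0) (Py t St ts)).
have [e e0 he] := walls_locally_finite p.
have near z : d p z < e -> Xplus d s C z -> C z.
  move=> pz Pz; apply: chamber_of_sides => t St.
  have [->//|ts] := pselect (t = s).
  have ht := S_refls St; have [hPt _] := Xplus_side ht; case: (hPt) => _ _ nfix _ _.
  have hrt : reflection d t by case: ht.
  apply/(ball_same_side hd hgeo hrt hPt _ pz); last exact: pP.
  by move=> q pq tq; apply: (nfix p (pP t St ts)); exact: (he t q).
have uniq_refl r : refls d W r -> r p = p -> r = s.
  move=> hr rp; have [Wr _] := hr; have [Ws _] := hs.
  have rK : involutive r by case: hr => _; exact: reflectionK.
  have sK : involutive s by case: hs => _; exact: reflectionK.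
  have off q e' : 0 < e' -> exists2 z, d q z < e' & s z <> z.
    case: hs => _ [_ _ nint _] e'0; apply: contrapT => h; apply: nint.
    exists q, e' => // z qz; apply: contrapT => sz; apply: h; by exists z.
  have [oP _ _ _ Por] := hP.
  have [c pc Pc] : exists2 c, d p c < e & Xplus d s C c.
    have [z pz /Por[Pz|Pz]] := off p e e0; first by exists z.
    by exists (s z) => //; rewrite -sp W_dist.
  have oPr : mopen d (r @^-1` (Defs.ball d p e `&` Xplus d s C)).
    by apply: mopen_preimage; [exact: W_dist|apply: mopenI oP; exact: ball_open].
  (* [r c] may lie on the wall of [s]; as walls have empty interior, it can be moved off to [z]
     while [r z] stays near [p] in the half-space of [s]. *)
  have [|e' e'0 sub] := oPr (r c); first by rewrite /= rK.
  have [z cz sz] := off (r c) e' e'0; have [/= prz Prz] := sub _ cz.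
  have pz : d p z < e by rewrite -(W_dist Wr) rp.
  have Crz := near _ prz Prz.
  have Csz : C (s z).
    case: (Por _ sz) => Pz; last by apply: near => //; rewrite -sp W_dist.
    exfalso; have [[_ _ _ PN _] CPr] := Xplus_side hr.
    exact: (PN z (CPr _ (near _ pz Pz)) (CPr _ Crz)).
  have : s \o r = id by apply: (chamber_fix (x := r z)) => //=; [exact: W_comp|rewrite rK].
  by move=> sr; apply/funext => q; rewrite -[LHS]sK -[s (r q)]/((s \o r) q) sr.
exists p, e => //; split=> // r q hr rs pq rq; apply: rs; apply: uniq_refl => //.
exact: (he r q).
Qed.

(** Near the panel point [p] only the wall of [s] occurs, so [c] and [s c] lie on the same side of
    [r]; from [s c] the side propagates through the image of [C] under [s], which meets no wall. *)
Lemma adjacent_same_side s r x : S s -> refls d W r -> r <> s -> C x ->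
  Xplus d r C (s x).
Proof.
move=> Ss hr rs Cx; have [p [e e0 [sp near avoid]]] := generator_panel Ss.
have hs := S_refls Ss; have [hP CP] := Xplus_side hr.
have [[_ _ _ _ Por] _] := Xplus_side hs.
have hrr : reflection d r by case: hr.
have Ws : W s by case: hs.
have [c pc Cc] : exists2 c, d p c < e & C c.
  case: hs => _ [_ _ nint _]; apply: contrapT => h; apply: nint.
  exists p, e => // z pz; apply: contrapT => sz; apply: h.
  case: (Por _ sz) => Pz; first by exists z => //; exact: near.
  by exists (s z); [rewrite -sp W_dist|apply: near => //; rewrite -sp W_dist].
have psc : d p (s c) < e by rewrite -sp W_dist.
have ball_side := ball_same_side hd hgeo hrr hP (fun z => avoid r z hr rs).
have Psc : Xplus d r C (s c).
  by apply/(ball_side _ psc)/(ball_side _ pc); exact: CP.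
apply: (side_segment hd hgeo hrr hP _ Psc) => z hz.
have sK : involutive s by case: hs => _; exact: reflectionK.
have := segment_image (W_dist Ws) hz; rewrite !sK => /chamber_convex hz'.
by rewrite -[z]sK; apply: orbit_off_walls => //; exact: hz'.
Qed.

(** [s] carries the wall of [s \o r \o s] to that of [r]; by adjacency [s x0] is still on the
    positive side of [r], so the sides match too. *)
Lemma Xplus_conj s r y : S s -> refls d W r -> r <> s ->
  Xplus d r C (s y) <-> Xplus d (s \o r \o s) C y.
Proof.
move=> Ss hr rs; have hs := S_refls Ss; have [Ws _] := hs.
have sK : involutive s by case: hs => _; exact: reflectionK.
have hr' := refls_conjJ hs hr.
have [hP CP] := Xplus_side hr; have [hP' CP'] := Xplus_side hr'.
have Psx := adjacent_same_side Ss hr rs hx0.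
have rr : reflection d r by case: hr.
have rr' : reflection d (s \o r \o s) by case: hr'.
split=> Py.
- apply: (side_segment hd hgeo rr' hP' _ (CP' _ hx0)) => z hz /= /(canRL sK) rz.
  case: (hP) => _ cv nfix _ _; apply: (nfix (s z)) => //.
  by apply: (cv _ _ Psx Py); exact: (segment_image (W_dist Ws)).
- apply: (side_segment hd hgeo rr hP _ Psx) => z hz rz.
  case: (hP') => _ cv nfix _ _; apply: (nfix (s z)); last by rewrite /= sK rz.
  apply: (cv _ _ (CP' _ hx0) Py).
  by have := segment_image (W_dist Ws) hz; rewrite !sK.
Qed.

(** * Inversions and word length *)

(** The inversion set of Coxeter theory. As [w x0] lies on no wall, not being on the positive side
    means being separated from [x0]. *)
Definition inversion (w r : T -> T) : Prop :=
  refls d W r /\ ~ Xplus d r C (w x0).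

(** [Xplus_conj] at the point [w x0]. Together with [inversion_self] it shows that an inversion [s]
    of [w] is lost in [s \o w], while the others are carried over by conjugation. *)
Lemma inversion_conj s w r : S s -> r <> s ->
  inversion (s \o w) r <-> inversion w (s \o r \o s).
Proof.
move=> Ss rs; have hs := S_refls Ss.
have sK : involutive s by case: hs => _; exact: reflectionK.
have rE : s \o (s \o r \o s) \o s = r by apply/funext => y /=; rewrite !sK.
split=> -[hr nP]; split=> //.
- exact: refls_conjJ.
- by move/(Xplus_conj _ Ss hr rs).
- by rewrite -rE; exact: refls_conjJ.
- have hr' : refls d W r by rewrite -rE; exact: refls_conjJ.
  by move/(Xplus_conj _ Ss hr' rs).
Qed.

Lemma inversion_self s w : S s -> W w -> inversion w s -> ~ inversion (s \o w) s.
Proof.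
move=> /S_refls hs Ww [_ nP] [_]; apply.
have [[_ _ _ _ Por] _] := Xplus_side hs.
by case: (Por _ (orbit_off_walls Ww hs hx0)).
Qed.

Lemma no_inversion w : W w -> (forall r, ~ inversion w r) -> w = id.
Proof.
move=> Ww h; apply: (chamber_fix Ww hx0); apply: chamber_of_sides => s Ss.
by apply: contrapT => nP; apply: (h s); split=> //; exact: S_refls.
Qed.

(** A separating wall meets the segment from [x0] to [w x0], so its reflection moves [x0] by at most
    twice the length of that segment, and properness applies. *)
Lemma finite_inversions w : W w -> exists2 L : seq {classic (T -> T)},
  uniq L & forall r, inversion w r <-> (r : {classic (T -> T)}) \in L.
Proof.
move=> Ww; pose n := 2 * d x0 (w x0) + 1.
have n0 : 0 < n by have := dist_ge0 hd x0 (w x0); rewrite /n; lra.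
have fin : finite_set (inversion w : set {classic (T -> T)}).
  apply: sub_finite_set (hprop x0 n0) => r [hr nP].
  have [Wr rr] := hr; split=> //; rewrite /Defs.ball /=; have [hP CP] := Xplus_side hr.
  have [z hz rz] : exists2 z, segment d x0 (w x0) z & r z = z.
    apply: contrapT => h; apply: nP.
    apply: (side_segment hd hgeo rr hP _ (CP _ hx0)) => z hz rz.
    by apply: h; exists z.
  case: hz => g [hg [t ht gt]]; have xz : d x0 z = t.
    case: (hg) => g0 _ _; rewrite -{1}g0 -gt.
    by rewrite (unit_speed_le (geodesic_unit_speed hg)); lra.
  have := dist_triangle hd z x0 (r x0); rewrite -{2}rz W_dist // (distC hd z) xz /n.
  lra.
have [s sE] := (@finite_seqP {classic (T -> T)} _).1 fin.
exists (undup s); first exact: undup_uniq.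
move=> r; rewrite mem_undup.
by rewrite -[inversion w r]/((inversion w : set {classic (T -> T)}) r) sE.
Qed.

Lemma word_in_cons s t : word_in S (s :: t) <-> S s /\ word_in S t.
Proof.
split=> [h|[Ss h] [|i] //=]; last exact: h.
by split; [exact: (h 0%N)|move=> i; exact: (h i.+1)].
Qed.

(** Each letter contributes at most one new inversion, itself, and conjugates the others; hence no
    word is shorter than the number of inversions of its product. *)
Lemma inversions_of_word t : word_in S t -> exists2 Q : seq {classic (T -> T)},
  size Q = size t &
  forall r, inversion (wprod t) r -> (r : {classic (T -> T)}) \in Q.
Proof.
elim: t => [|s t IH] ht.
  exists [::] => // r [hr]; case; have [_ CP] := Xplus_side hr.
  exact: CP.
have /word_in_cons[Ss /IH[Q QE hQ]] := ht.
pose conj_s (r : {classic (T -> T)}) : {classic (T -> T)} := s \o (r : T -> T) \o s.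
exists ((s : {classic (T -> T)}) :: [seq conj_s r | r <- Q]).
  by rewrite /= size_map QE.
move=> r hr; rewrite inE; have [->|/eqP rs] := eqVneq (r : {classic (T -> T)}) s.
  by [].
have sK : involutive s by case: (S_refls Ss) => _; exact: reflectionK.
have := (inversion_conj (wprod t) Ss rs).1 hr => /hQ h.
have -> : r = conj_s (s \o r \o s) by apply/funext => y; rewrite /conj_s /= !sK.
by apply/orP; right; exact: map_f.
Qed.

(** * Paths crossing the walls, and the gallery along them *)

(** What the recursion keeps of the geodesic. After folding at a wall the path starts on that wall,
    so its initial point is only required to be in the closure of [C]. *)
Definition transverse_path (w : T -> T) (g : R -> T) (a b : R) : Prop :=
  [/\ a <= b, unit_speed d g a b, g b = w x0, mclosure d C (g a) &
    forall r t t', refls d W r -> a <= t <= b -> a <= t' <= b ->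
      r (g t) = g t -> r (g t') = g t' -> t = t'].

(** If the wall were met at some [u > a], both [g a] and [g b] would be strictly on the positive
    side, which convexity forbids. The time [a] is excluded because [g a] may lie on the wall. *)
Lemma path_never_leaves w g a b r t : W w -> transverse_path w g a b ->
  refls d W r -> ~ inversion w r -> a < t <= b -> Xplus d r C (g t).
Proof.
move=> Ww [ab hg gb Cga once] hr ninv ht; have [hP CP] := Xplus_side hr.
have rr : reflection d r by case: hr.
have Pb : Xplus d r C (g b).
  by rewrite gb; apply: contrapT => nP; apply: ninv.
have [[u hu ru]|nfix] := pselect (exists2 u, t <= u <= b & r (g u) = g u); last first.
  apply: (side_path hd rr hP (unit_speed_sub hg (_ : a <= t) (lexx b)) _ _ _ Pb); try lra.
  by move=> u hu ru; apply: nfix; exists u.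
have Pa : Xplus d r C (g a).
  apply: chamber_closure_side => // ra.
  by have := once r a u hr; move=> /(_ _ _ ra ru); lra.
case: (hP) => _ cv nfix _ _; exfalso; apply: (nfix (g u)) => //.
by apply: (convex_unit_speed cv hg) => //; lra.
Qed.

(** The wall is met exactly once, and the sides before and after are those of the two ends.
    [tau = a] is possible; [tau = b] is not, as [w x0] lies on no wall. *)
Lemma path_crosses w g a b r : W w -> transverse_path w g a b -> inversion w r ->
  exists tau, [/\ a <= tau < b, r (g tau) = g tau,
    forall t, a <= t < tau -> Xplus d r C (g t) &
    forall t, tau < t <= b -> ~ Xplus d r C (g t)].
Proof.
move=> Ww [ab hg gb Cga once] [hr nP]; have [hP CP] := Xplus_side hr.
have rr : reflection d r by case: hr.
have [tau htau rtau] : exists2 tau, a <= tau <= b & r (g tau) = g tau.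
  apply: contrapT => nfix; apply: nP; rewrite -gb.
  apply: (side_path hd rr hP hg _ (_ : a <= a <= b)); try lra.
  - by move=> u hu ru; apply: nfix; exists u.
  - apply: chamber_closure_side => // ra; apply: nfix; exists a => //; lra.
have tb : tau != b.
  apply/eqP => tE; rewrite tE gb in rtau; exact: (orbit_off_walls Ww hr hx0).
exists tau; split=> //.
- by case/andP: htau => -> /=; rewrite le_eqVlt (negbTE tb).
- move=> t ht.
  apply: (side_path hd rr hP (unit_speed_sub hg (lexx a) (_ : t <= b)) _
    (_ : a <= a <= t)); try lra.
    move=> u hu ru; have : u = tau by apply: (once r) => //; lra.
    lra.
  apply: chamber_closure_side => // ra.
  have : a = tau by apply: (once r) => //; lra.
  lra.
- move=> t ht Pt; apply: nP; rewrite -gb.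
  apply: (side_path hd rr hP (unit_speed_sub hg (_ : a <= t) (lexx b)) _ _ _ Pt); try lra.
  move=> u hu ru; have : u = tau by apply: (once r) => //; lra.
  lra.
Qed.

(** [diam] is a [sup], which bounds distances only if the set is bounded; compactness gives this
    through the balls of integer radius about [x0]. *)
Lemma closure_dist p : mclosure d C p -> d p x0 <= diam d (mclosure d C).
Proof.
move=> Cp; have Cx : mclosure d C x0 by move=> e e0; exists x0; rewrite ?(dist0 hd).
have [cpt _] := hcc.
have [n [f cov]] : exists n (f : nat -> nat), mclosure d C `<=`
    [set x | exists2 i, (i < n)%N & Defs.ball d x0 (f i)%:R x].
  apply: (cpt nat (fun k => Defs.ball d x0 k%:R)); first by move=> k; exact: ball_open.
  move=> x _; exists (Num.truncn (d x0 x)).+1 => //.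
  by rewrite /Defs.ball /= truncnS_gt.
have bnd x : mclosure d C x -> d x0 x <= (\max_(i < n) f i)%:R.
  move=> /cov[i iltn]; rewrite /Defs.ball /= => /ltW h; apply: (le_trans h).
  by rewrite ler_nat; exact: (leq_bigmax (Ordinal iltn)).
apply: ub_le_sup; last by exists p => //; exists x0.
exists ((\max_(i < n) f i)%:R *+ 2) => _ [x /bnd hx [y /bnd hy <-]].
by have := dist_triangle hd x0 x y; rewrite (distC hd x x0) mulr2n; lra.
Qed.

(** Conjugation by [s] turns walls met by [s \o g] into walls met by [g], so each is still met at
    most once; [g tau] is fixed by [s] and stays in the closure of [C]. *)
Lemma transverse_step s w g a b tau : S s -> W w -> transverse_path w g a b ->
  a <= tau <= b -> s (g tau) = g tau -> mclosure d C (g tau) ->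
  transverse_path (s \o w) (s \o g) tau b.
Proof.
move=> /S_refls hs Ww [ab hg gb Cga once] htau stau Ctau.
have [Ws _] := hs; have sK : involutive s by case: hs => _; exact: reflectionK.
split=> //=; [lra| |by rewrite gb|by rewrite stau|].
  apply: unit_speed_comp; first exact: W_dist.
  by apply: unit_speed_sub hg _ _; lra.
move=> r t t' hr ht ht' rt rt'; apply: (once (s \o r \o s)).
- exact: refls_conjJ.
- lra.
- lra.
- by rewrite /= rt sK.
- by rewrite /= rt' sK.
Qed.

(** The least crossing time is attained by some [r1], perhaps not a generator. If no generator wall
    were crossed at that time, [g] would remain in [C] shortly after it, though already beyond the
    wall of [r1]. *)
Lemma first_wall w g a b r0 : W w -> transverse_path w g a b -> inversion w r0 ->
  exists s tau, [/\ S s, inversion w s, a <= tau < b, s (g tau) = g tau &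
    forall t, a <= t <= tau -> mclosure d C (g t)].
Proof.
move=> Ww hpath inv0; have [ab hg gb Cga once] := hpath.
have [L uL hL] := finite_inversions Ww.
have [tau htau] : exists tau : {classic (T -> T)} -> R, forall r, inversion w r ->
    [/\ a <= tau r < b, (r : T -> T) (g (tau r)) = g (tau r),
    forall t, a <= t < tau r -> Xplus d r C (g t) &
    forall t, tau r < t <= b -> ~ Xplus d r C (g t)].
  have crossing (r : {classic (T -> T)}) : exists u, inversion w r ->
      [/\ a <= u < b, (r : T -> T) (g u) = g u,
      forall t, a <= t < u -> Xplus d r C (g t) &
      forall t, u < t <= b -> ~ Xplus d r C (g t)].
    have [i|ni] := pselect (inversion w r); last by exists 0.
    by have [u hu] := path_crosses Ww hpath i; exists u.
  by have [tau htau] := choice crossing; exists tau.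
have [r1 r1L rmin] := seq_argmin tau r0 L.
have r1L' : r1 \in L by move: r1L; rewrite inE => /predU1P[->|//]; apply/hL.
have inv1 : inversion w r1 by apply/hL.
have r_min r : inversion w r -> tau r1 <= tau r.
  by move=> /hL rL; apply: rmin; rewrite inE rL orbT.
have [ht1 rt1 before1 after1] := htau _ inv1.
have inC t : a < t < tau r1 -> C (g t).
  move=> ht; apply: chamber_of_sides => s /S_refls hs.
  have [i|ni] := pselect (inversion w s); last first.
    by apply: (path_never_leaves Ww hpath hs ni); lra.
  have [_ _ before _] := htau s i; apply: before.
  by have := r_min s i; lra.
(* Approach [g t] from earlier times [u]: the midpoint keeps [u] beyond [a], and [t - e / 2] keeps
   it within [e] of [t]. *)
have clC t : a <= t <= tau r1 -> mclosure d C (g t).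
  move=> ht; have [ta|/eqP ta] := pselect (t = a); first by rewrite ta.
  have at_ : a < t by rewrite lt_neqAle eq_sym ta; lra.
  move=> e e0; pose u := Num.max ((a + t) / 2) (t - e / 2).
  have u1 : (a + t) / 2 <= u by rewrite le_max lexx.
  have u2 : t - e / 2 <= u by rewrite le_max lexx orbT.
  have u3 : u < t by rewrite gt_max; apply/andP; split; lra.
  exists (g u); first by apply: inC; lra.
  by rewrite (distC hd) (unit_speed_le hg); lra.
have [s [Ss si st]] : exists s, [/\ S s, inversion w s & tau s = tau r1].
  apply: contrapT => none.
  (* [e] lies below all positive gaps [tau r - tau r1], so up to time [t] no further generator wall
     is crossed. *)
  have [e e0 he] := positive_lower_bound (fun r => tau r - tau r1) L.
  pose t := Num.min b (tau r1 + e).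
  have t1 : tau r1 < t by rewrite lt_min; apply/andP; split; lra.
  have t2 : t <= b by rewrite ge_min lexx.
  have t3 : t <= tau r1 + e by rewrite ge_min lexx orbT.
  have [_ CP] := Xplus_side inv1.1.
  apply: (after1 t); first by lra.
  apply: CP; apply: chamber_of_sides => s Ss; have hs := S_refls Ss.
  have [i|ni] := pselect (inversion w s); last first.
    by apply: (path_never_leaves Ww hpath hs ni); lra.
  have [_ _ before _] := htau s i; apply: before.
  have lt1s : tau r1 < tau s.
    rewrite lt_neqAle r_min // andbT; apply/eqP => ts; apply: none.
    by exists s.
  have := he s ((hL s).1 i); lra.
have [hts sts _ _] := htau s si.
by rewrite st in sts; exists s, (tau r1).
Qed.

(** Induction on the number of inversions. For the two halves of the Hausdorff bound it carries
    along a point of [g] near both ends of each edge, and a vertex near each point of [g]; index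
    [size s] is the last vertex. *)
Lemma gallery_along_path w g a b (L : seq {classic (T -> T)}) : W w ->
  uniq L -> (forall r, inversion w r <-> (r : {classic (T -> T)}) \in L) ->
  transverse_path w g a b ->
  exists s, [/\ word_in S s, wprod s = w, size s = size L,
    forall i, (i < size s)%N -> exists2 t, a <= t <= b &
      d (g t) (wprod (take i s) x0) <= diam d (mclosure d C) /\
      d (g t) (wprod (take i.+1 s) x0) <= diam d (mclosure d C) &
    forall t, a <= t <= b -> exists2 i, (i <= size s)%N &
      d (g t) (wprod (take i s) x0) <= diam d (mclosure d C)].
Proof.
move sizeL: (size L) => n; elim: n w g a L sizeL => [|n IH] w g a L sizeL Ww uL hL hpath.
  have ninv r : ~ inversion w r by rewrite hL (size0nil sizeL).
  have [ab hg gb Cga once] := hpath.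
  exists [::]; split=> //; first by rewrite (no_inversion Ww ninv).
  move=> t ht; exists 0%N => //=; apply: closure_dist.
  have [ta|/eqP ta] := pselect (t = a); first by rewrite ta.
  have Ct : C (g t).
    apply: chamber_of_sides => s /S_refls hs.
    apply: (path_never_leaves Ww hpath hs (ninv s)).
    by rewrite lt_neqAle eq_sym ta; lra.
  by move=> e e0; exists (g t); rewrite ?(dist0 hd).
have [r0 inv0] : exists r0, inversion w r0.
  by case: L sizeL hL {uL} => // r0 L _ hL; exists r0; apply/hL; exact: mem_head.
have [s [tau [Ss sinv htau stau clC]]] := first_wall Ww hpath inv0.
have [Ws _] := S_refls Ss.
have sK : involutive s by case: (S_refls Ss) => _; exact: reflectionK.
pose conj_s (r : {classic (T -> T)}) : {classic (T -> T)} := s \o (r : T -> T) \o s.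
have conj_sK : involutive conj_s by move=> r; apply/funext => y; rewrite /conj_s /= !sK.
have conj_ss : conj_s s = s by apply/funext => y; rewrite /conj_s /= sK.
have sL : (s : {classic (T -> T)}) \in L by apply/hL.
(* Inversions of [s \o w]: remove [s] and conjugate the rest. *)
pose L' := [seq conj_s r | r <- rem (s : {classic (T -> T)}) L].
have hpath' : transverse_path (s \o w) (s \o g) tau b.
  by apply: (transverse_step Ss Ww hpath) => //; [lra|apply: clC; lra].
have hL' r : inversion (s \o w) r <-> (r : {classic (T -> T)}) \in L'.
  rewrite -[r in X in _ <-> X]conj_sK (mem_map (can_inj conj_sK)) mem_rem_uniq // inE.
  have [->|/eqP rs] := eqVneq (r : {classic (T -> T)}) s.
    by rewrite conj_ss eqxx; split=> // /(inversion_self Ss Ww sinv).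
  have -> : conj_s r != s.
    by apply/eqP => h; apply: rs; rewrite -[LHS](conj_sK r) h conj_ss.
  by rewrite (inversion_conj _ Ss rs) hL.
have sizeL' : size L' = n by rewrite size_map size_rem // sizeL.
have uL' : uniq L' by rewrite (map_inj_uniq (can_inj conj_sK)) rem_uniq.
have [t [tS tw tsize edges points]] :=
  IH _ _ _ L' sizeL' (W_comp Ws Ww) uL' hL' hpath'.
have dist_s u y : d (g u) (s y) = d ((s \o g) u) y by rewrite /= -(W_dist Ws) sK.
have Cx0 : forall u, a <= u <= tau -> d (g u) x0 <= diam d (mclosure d C).
  by move=> u /clC; exact: closure_dist.
exists (s :: t); split.
- by apply/word_in_cons.
- by rewrite /= tw; apply/funext => y; rewrite /= sK.
- by rewrite /= tsize.
(* On the first edge, [g tau] is within the diameter of [x0] and, being fixed by [s], also of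
   [s x0]; later edges come from the folded path. *)
- move=> [|i] hi.
    exists tau; first by lra.
    rewrite take0 /= take0 /=; split; first by apply: Cx0; lra.
    by rewrite dist_s /= stau; apply: Cx0; lra.
  have [u hu [h1 h2]] := edges i hi; exists u; first by lra.
  by rewrite /= !dist_s.
- move=> u hu; have [ut|tu] := leP u tau.
    by exists 0%N => //=; apply: Cx0; lra.
  have [|i hi h] := points u; first by lra.
  by exists i.+1 => //=; rewrite dist_s.
Qed.

(** If [w x0] is on the same side of [r] as [x0], convexity keeps the geodesic off the wall;
    otherwise [fix_at_most_once] applies. *)
Lemma geodesic_transverse w g : W w -> geodesic d x0 (w x0) g ->
  transverse_path w g 0 (d x0 (w x0)).
Proof.
move=> Ww hg; have hu := geodesic_unit_speed hg; case: (hg) => g0 gd _.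
split=> //; first exact: dist_ge0.
  by rewrite g0 => e e0; exists x0; rewrite ?(dist0 hd).
move=> r t t' hr ht ht' rt rt'; have [[_ cv nfix _ Por] CP] := Xplus_side hr.
have Px := CP _ hx0; rewrite -g0 in Px.
have [Pw|Pw] := Por _ (orbit_off_walls Ww hr hx0); rewrite -gd in Pw.
  by case: (nfix (g t)) => //; exact: (convex_unit_speed cv hu ht Px Pw).
exact: (fix_at_most_once hd hcat (W_dist hr.1) cv nfix hu Px Pw ht ht' rt rt').
Qed.

End ReflectionGroups.

(** * Reducedness and the Hausdorff bound *)

Lemma hausdorff_dist_le (R : realType) (T : Type) (d : T -> T -> R)
  (A B : set T) (e : R) : 0 <= e ->
  (forall a, A a -> exists2 b, B b & d a b <= e) ->
  (forall b, B b -> exists2 a, A a & d b a <= e) ->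
  (hausdorff_dist d A B <= e%:E)%E.
Proof. by move=> e0 hA hB; apply: ereal_inf_lbound; exists e. Qed.

Theorem theorem3p3 (R : realType) (T : Type) (d : T -> T -> R)
  (hd : is_metric d) (hcat : CAT0 d)
  (W : set (T -> T)) (hW : reflection_group d W) (hprop : acts_properly d W)
  (C : set T) (hC : chamber d W C) (hcc : cocompact_discrete d W C)
  (S : set (T -> T)) (hS : minimal_wall_set d W C S)
  (x0 : T) (hx0 : C x0) (w : T -> T) (hw : W w) :
  exists s : seq (T -> T), reduced_rep S w s /\
    (hausdorff_dist d (segment d x0 (w x0)) (gallery_path d x0 s)
       <= (diam d (mclosure d C))%:E)%E.
Proof.
have [hgeo _] := hcat; set D := diam d (mclosure d C).
have [L uL hL] := finite_inversions hd hcat hW hprop hC hx0 hw.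
have [g hg] := hgeo x0 (w x0); have [g0 gd _] := hg.
have [s [sS sw ssize edges points]] := gallery_along_path hd hcat hW hprop hC
  hcc hS hx0 hw uL hL (geodesic_transverse hd hcat hW hC hx0 hw hg).
exists s; split.
  (* Any word for [w] is at least as long as the duplicate-free list [L] of its inversions. *)
  split=> // t tS tw; have [Q <- hQ] :=
    inversions_of_word hd hcat hW hprop hC hcc hS hx0 tS.
  by rewrite ssize; apply: uniq_leq_size uL _ => r /hL; rewrite -tw => /hQ.
have D0 : 0 <= D.
  apply: le_trans (closure_dist hd hcc hx0 (p := x0) _); first exact: dist_ge0.
  by move=> e e0; exists x0; rewrite ?(dist0 hd).
have dw := dist_ge0 hd x0 (w x0).
apply: hausdorff_dist_le => // [a [g' [hg' [t ht <-]]]|b].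
  rewrite -(geodesic_unique hd hcat hg hg' ht); have [i hi h] := points t ht.
  (* Vertex 0 is the separate point [x0] of [gallery_path]; vertex [i.+1] is the far end of edge
     [i]. *)
  exists (wprod (take i s) x0) => //; case: i hi {h} => [|i] hi; first by left; rewrite take0.
  right; exists i => //; set u := wprod _ x0; set v := wprod (take i.+1 s) x0.
  have [h hh] := hgeo u v; exists h; split=> //.
  by exists (d u v); [rewrite lexx dist_ge0|case: hh].
case=> [->|[i hi hb]].
  exists x0; last by rewrite (dist0 hd).
  by exists g; split=> //; exists 0; rewrite ?lexx.
(* [g t] is near both ends of the edge, hence near all of it by convexity of balls. *)
have [t ht [h1 h2]] := edges i hi; exists (g t); first by exists g; split=> //; exists t.
by rewrite (distC hd); exact: (dist_segment_le hd hcat h1 h2 hb).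
Qed.
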